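(* For any positive integer $n$ and any integer $a$, the set $$\mathcal{M}_{n,a}:=\{w\in\mathcal{M}_n\mid l(w)\equiv a\pmod{n+1}\}$$ is a perfect code, i.e. (1) for any different $w,w'\in\mathcal{M}_{n,a}$, $\mathrm{dS}(w)\cap\mathrm{dS}(w')=\emptyset$, and (2) $\bigcup_{w\in\mathcal{M}_{n,a}}\mathrm{dS}(w)=\mathcal{M}_{n-1}$.
   Context: For $m\ge1$ let $\epsilon_1,\dots,\epsilon_m$ be the standard basis of $\mathbb{R}^m$, $\alpha_1:=\epsilon_1$, $\alpha_i:=\epsilon_i-\epsilon_{i-1}$ for $2\le i\le m$, $s_i$ the orthogonal reflection associated with $\alpha_i$, and $W(B_m)$ the group generated by $s_1,\dots,s_m$ ($W(B_0)$ is trivial). $W(B_m)$ is regarded as the subgroup of $W(B_{m+1})$ generated by $s_1,\dots,s_m$. The length $l(w)$ is the least number of generators $s_i$ in an expression of $w$. For $J=\{j_1<\dots<j_t\}\subseteq\{1,\dots,m\}$ let $w_J:=w_{j_1}w_{j_2}\cdots w_{j_t}$ (composition of maps, rightmost applied first), where $w_j:=s_js_{j-1}\cdots s_1$ and $w_\emptyset=\mathrm{id}$; let $\mathcal{M}_m:=\{w_J\mid J\subseteq\{1,\dots,m\}\}$, so $\mathcal{M}_m\subset\mathcal{M}_{m+1}$. Let $W(A_{m-1})$ be the subgroup of $W(B_m)$ generated by $s_2,\dots,s_m$. $\mathcal{M}_m$ is the set of minimal-length representatives of the cosets $[w]=wW(A_{m-1})$, and $W(B_m)$ acts on $\mathcal{M}_m$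 by $v\cdot w:=$ the minimal-length representative of $[vw]$. For $0\le j\le 2m+1$ define $\mathcal{I}^{(m)}_j\in W(B_{m+1})$: $\mathcal{I}^{(m)}_0:=\mathrm{id}$; $\mathcal{I}^{(m)}_j:=s_{m+2-j}\cdots s_ms_{m+1}$ for $1\le j\le m$; $\mathcal{I}^{(m)}_j:=s_{j-m}\cdots s_2s_1\mathcal{I}^{(m)}_m$ for $m+1\le j\le2m+1$. For $y\in\mathcal{M}_m$ the insertion sphere is $\mathrm{iS}(y):=\{\mathcal{I}^{(m)}_j\cdot y\mid 0\le j\le 2m+1\}\subset\mathcal{M}_{m+1}$. For $w\in\mathcal{M}_n$ the deletion sphere is $\mathrm{dS}(w):=\{y\in\mathcal{M}_{n-1}\mid w\in\mathrm{iS}(y)\}$. *)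

(* Defs.v *)
From HB Require Import structures.
From mathcomp Require Import all_boot all_order all_algebra.
From mathcomp Require Import all_classical all_reals.

Set Implicit Arguments.
Unset Strict Implicit.
Unset Printing Implicit Defensive.
Import Order.TTheory GRing.Theory Num.Theory.
Local Open Scope classical_set_scope.
Local Open Scope ring_scope.

(* All groups W(B_m) with m <= N are realized as groups of N x N matrices
   acting on column vectors of R^N, so that the inclusion of W(B_m) into
   W(B_(m+1)) as the subgroup generated by s_1, .., s_m is the identity on
   matrices, and the matrix product is the composition of maps (rightmost
   factor applied first). Indices i, j are natural numbers starting from 1;
   m is the rank and N the ambient dimension. *)
Section TypeB.
Variables (R : realType) (N : nat).
Implicit Types (u J : seq nat) (w x y : 'M[R]_N).

Definition eps (i : nat) : 'cV[R]_N := \col_(k < N) (k.+1 == i)%:R.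

Definition alpha (i : nat) : 'cV[R]_N :=
  if i == 1%N then eps 1 else eps i - eps i.-1.

Definition dotp (v w : 'cV[R]_N) : R := \sum_(k < N) v k 0 * w k 0.

(* The matrix of v |-> v - 2 (v, a) / (a, a) a. *)
Definition reflection (a : 'cV[R]_N) : 'M[R]_N :=
  1%:M - (2 / dotp a a) *: (a *m a^T).

Definition s (i : nat) : 'M[R]_N := reflection (alpha i).

Definition sprod u : 'M[R]_N := \big[mulmx/1%:M]_(i <- u) s i.

Definition is_subgroup (H : set 'M[R]_N) : Prop :=
  [/\ H `<=` [set` unitmx], H 1%:M,
      forall x y, H x -> H y -> H (x *m y) &
      forall x, H x -> H (invmx x)].

(* W(A_(m-1)) *)
Definition WA (m : nat) : set 'M[R]_N :=
  smallest is_subgroup [set s i | i in [set i | (2 <= i <= m)%N]].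

Definition expressible (m : nat) w (k : nat) : Prop :=
  exists u, [/\ all (fun i => 1 <= i <= m)%N u, size u = k & sprod u = w].

(* The default value 0 is only reached when w is not in W(B_m). *)
Definition len (m : nat) w : nat :=
  xget 0%N [set k | expressible m w k /\
                    forall k', expressible m w k' -> (k <= k')%N].

Definition wgen (j : nat) : 'M[R]_N := sprod (rev (iota 1 j)).

(* A subset J of {1, .., m} is given by its increasing enumeration. *)
Definition wJ J : 'M[R]_N := \big[mulmx/1%:M]_(j <- J) wgen j.

Definition MB (m : nat) : set 'M[R]_N :=
  [set wJ J | J in [set J | sorted ltn J /\ all (fun j => 1 <= j <= m)%N J]].

Definition coset (m : nat) w : set 'M[R]_N := [set w *m v | v in WA m].

Definition minrep (m : nat) w : 'M[R]_N :=
  xget 1%:M [set x | coset m w x /\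
                     forall y, coset m w y -> (len m x <= len m y)%N].

Definition act (m : nat) (v w : 'M[R]_N) : 'M[R]_N := minrep m (v *m w).

(* s_(m+2-j) .. s_m s_(m+1), which is the identity for j = 0. *)
Definition ins_low (m j : nat) : 'M[R]_N := sprod (iota (m + 2 - j) j).

Definition ins (m j : nat) : 'M[R]_N :=
  if (j <= m)%N then ins_low m j
  else sprod (rev (iota 1 (j - m))) *m ins_low m m.

Definition iS (m : nat) y : set 'M[R]_N :=
  [set act m.+1 (ins m j) y | j in [set j | (j <= 2 * m + 1)%N]].

Definition dS (n : nat) w : set 'M[R]_N :=
  [set y | MB n.-1 y /\ iS n.-1 y w].

End TypeB.

Definition Mcode (R : realType) (n : nat) (a : int) : set 'M[R]_n :=
  [set w : 'M[R]_n | MB n w /\ ((len n w)%:Z = a %[mod n.+1])%Z].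
Arguments Mcode : clear implicits.

(* Main.v *)
Require Import Defs.
From HB Require Import structures.
From mathcomp Require Import all_boot all_order all_algebra.
From mathcomp Require Import all_classical all_reals.
From mathcomp Require Import zify ring.

Set Implicit Arguments.
Unset Strict Implicit.
Unset Printing Implicit Defensive.
Import Order.TTheory GRing.Theory Num.Theory.
Local Open Scope classical_set_scope.
Local Open Scope ring_scope.

(* The orbit of the all-ones vector under W(B_N) consists of the sign vectors,
   and w_J sends it to the vector with entries -1 exactly on J.  A generator
   changes the sum of the elements of J by at most 1, and it multiplies w_J to
   another w_J' unless it fixes J, in which case it moves through w_J into
   W(A_(N-1)).  Hence w_J is the unique shortest element of its coset, its
   length is the sum of J, and the insertions I_j y become insertions of a
   single sign into a sign vector.  When j increases by one, the length of
   I_j y either increases by one or I_j y does not change, and altogether it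
   increases by n.  So exactly one element of the insertion sphere of y has its
   length in a prescribed residue class modulo n + 1. *)

(** * Reflections in Euclidean space *)

Section Reflections.
Variables (R : realType) (N : nat).
Implicit Types (a b v w : 'cV[R]_N).

Lemma dotpE v w : v^T *m w = (dotp v w)%:M.
Proof.
apply/matrixP => i j; rewrite !ord1 !mxE eqxx mulr1n.
by apply: eq_bigr => k _; rewrite !mxE.
Qed.

Lemma dotpC v w : dotp v w = dotp w v.
Proof. by apply: eq_bigr => k _; rewrite mulrC. Qed.

Lemma dotpDl u v w : dotp (u + v) w = dotp u w + dotp v w.
Proof.
by rewrite -big_split; apply: eq_bigr => k _; rewrite mxE mulrDl.
Qed.

Lemma dotpBl u v w : dotp (u - v) w = dotp u w - dotp v w.
Proof.
by rewrite -sumrB; apply: eq_bigr => k _; rewrite !mxE mulrBl.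
Qed.

Lemma dotpDr u v w : dotp w (u + v) = dotp w u + dotp w v.
Proof. by rewrite dotpC dotpDl !(dotpC w). Qed.

Lemma dotpBr u v w : dotp w (u - v) = dotp w u - dotp w v.
Proof. by rewrite dotpC dotpBl !(dotpC w). Qed.

Lemma reflectionE a v :
  reflection a *m v = v - (2 / dotp a a * dotp a v) *: a.
Proof.
rewrite mulmxBl mul1mx -scalemxAl -mulmxA dotpE.
by rewrite mul_mx_scalar scalerA.
Qed.

Lemma tr_reflection a : (reflection a)^T = reflection a.
Proof.
by rewrite /reflection linearB linearZ /= trmx1 trmx_mul trmxK.
Qed.

Lemma reflectionK a : dotp a a != 0 -> reflection a *m reflection a = 1%:M.
Proof.
move=> a0; rewrite {2}/reflection mulmxBr mulmx1 -scalemxAr mulmxA reflectionE.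
rewrite divfK // (_ : a - 2 *: a = - a); last first.
  by apply/matrixP => i j; rewrite !mxE; ring.
by rewrite mulNmx scalerN opprK /reflection subrK.
Qed.

(** A reflection is symmetric and involutive, hence orthogonal, so conjugation only changes the
    root. The braid relations below thus reduce to computing images of roots. *)
Lemma reflectionJ a b : dotp b b != 0 ->
  reflection b *m reflection a *m reflection b = reflection (reflection b *m a).
Proof.
move=> b0; have Kb := reflectionK b0.
have tr_ba : (reflection b *m a)^T = a^T *m reflection b.
  by rewrite trmx_mul tr_reflection.
have dot_ba : dotp (reflection b *m a) (reflection b *m a) = dotp a a.
  suff /matrixP/(_ 0 0) :
      (dotp (reflection b *m a) (reflection b *m a))%:M = (dotp a a)%:M :> 'M_1.
    by rewrite !mxE.
  by rewrite -!dotpE tr_ba -mulmxA (mulmxA _ _ a) Kb mul1mx.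
have expand (B : 'M[R]_N) c : B *m (1%:M - c *: (a *m a^T)) *m B =
    B *m B - c *: (B *m a *m (a^T *m B)).
  by rewrite mulmxBr mulmxBl mulmx1 -scalemxAr -scalemxAl !mulmxA.
by rewrite [RHS]/reflection dot_ba tr_ba -Kb; apply: expand.
Qed.

Lemma reflection_comm a b : dotp b b != 0 -> dotp b a = 0 ->
  reflection a *m reflection b = reflection b *m reflection a.
Proof.
move=> b0 ba0; have := reflectionJ a b0.
rewrite reflectionE ba0 mulr0 scale0r subr0 => {2}<-.
by rewrite 2!mulmxA reflectionK // mul1mx.
Qed.

Lemma dotp_eps (k : 'I_N) v : dotp (eps R N k.+1) v = v k 0.
Proof.
rewrite /dotp (bigD1 k) //= mxE eqxx mul1r big1 ?addr0 // => i ik.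
by rewrite mxE eqSS (negbTE (_ : val i != val k)) ?mul0r.
Qed.

Lemma dotp_eps_eps i j : (0 < i <= N)%N -> dotp (eps R N i) (eps R N j) = (i == j)%:R.
Proof.
case: i => // i /= iN; rewrite (dotp_eps (Ordinal iN)) mxE //.
Qed.
End Reflections.

(** * Coxeter relations of type B *)

Section Coxeter.
Variables (R : realType) (N : nat).
Local Notation s := (s R N).
Local Notation alpha := (alpha R N).
Local Notation eps := (eps R N).

Lemma alpha_succ i : alpha i.+2 = eps i.+2 - eps i.+1.
Proof. by []. Qed.

Lemma dotp_alpha1 : (0 < N)%N -> dotp (alpha 1%N) (alpha 1%N) = 1.
Proof. by move=> N0; rewrite dotp_eps_eps. Qed.

Lemma dotp_alpha i : (i.+2 <= N)%N -> dotp (alpha i.+2) (alpha i.+2) = 2.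
Proof.
move=> iN; rewrite !alpha_succ dotpBl !dotpBr !dotp_eps_eps ?iN ?(ltnW iN) //.
rewrite !eqxx (gtn_eqF (ltnSn _)) (ltn_eqF (ltnSn _)) /=; ring.
Qed.

Lemma dotp_alpha_neq0 i : (0 < i <= N)%N -> dotp (alpha i) (alpha i) != 0.
Proof.
case: i => [|[|i]] // /andP[_ iN]; first by rewrite dotp_alpha1 // oner_neq0.
by rewrite dotp_alpha // pnatr_eq0.
Qed.

Lemma sK i : (0 < i <= N)%N -> s i *m s i = 1%:M.
Proof. by move=> iN; apply: reflectionK; apply: dotp_alpha_neq0. Qed.

Lemma s_comm i j : (0 < i)%N -> (i.+1 < j)%N -> (j <= N)%N ->
  s i *m s j = s j *m s i.
Proof.
move=> i0 ij jN; apply: reflection_comm; first by apply: dotp_alpha_neq0; lia.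
case: j ij jN => [|[|j]] // ij jN.
rewrite alpha_succ /alpha; case: ifP => [/eqP i1|i1].
  rewrite dotpBl !dotp_eps_eps; try lia.
  by rewrite !gtn_eqF ?subrr //; lia.
rewrite !dotpBr !dotpBl !dotp_eps_eps; try lia.
rewrite !gtn_eqF ?subrr //; lia.
Qed.

(** Both sides are conjugates of a reflection, with the same root [alpha i + alpha i.+1]. *)
Lemma s_braid i : (1 < i)%N -> (i < N)%N ->
  s i *m s i.+1 *m s i = s i.+1 *m s i *m s i.+1.
Proof.
case: i => [|[|i]] // _ iN.
rewrite !reflectionJ; try by apply: dotp_alpha_neq0; lia.
congr reflection; rewrite !reflectionE !dotp_alpha //; try lia.
have d : dotp (alpha i.+2) (alpha i.+3) = -1.
  rewrite !alpha_succ !dotpBr !dotpBl !dotp_eps_eps; try lia.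
  by rewrite eqxx !ltn_eqF //=; ring.
rewrite (dotpC (alpha i.+3)) d divff ?pnatr_eq0 // mul1r scaleN1r scaleN1r.
by rewrite !opprK addrC.
Qed.

(** The relation says that s_2 commutes with s_1 s_2 s_1, the reflection in [eps 2 + eps 1], which
    is orthogonal to [alpha 2]. *)
Lemma s_braid4 : (1 < N)%N ->
  s 2%N *m s 1%N *m s 2%N *m s 1%N = s 1%N *m s 2%N *m s 1%N *m s 2%N.
Proof.
move=> N1; have d1 := dotp_alpha1 (ltnW N1).
rewrite -(mulmxA (s 2%N *m _)) -(mulmxA (s 2%N)) (mulmxA (s 1%N)).
rewrite !reflectionJ; try by apply: dotp_alpha_neq0; lia.
have n0 : dotp (eps 2%N + eps 1%N) (eps 2%N + eps 1%N) != 0.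
  rewrite dotpDl !dotpDr !dotp_eps_eps; try lia.
  by rewrite /= add0r addr0 -natrD pnatr_eq0.
suff -> : reflection (alpha 1%N) *m alpha 2%N = eps 2%N + eps 1%N.
  apply: reflection_comm n0 _.
  rewrite alpha_succ dotpDl !dotpBr !dotp_eps_eps; try lia.
  by rewrite /=; ring.
rewrite reflectionE d1 alpha_succ {1}/alpha /= dotpBr !dotp_eps_eps; try lia.
by apply/matrixP => i j; rewrite !mxE divr1 /=; ring.
Qed.
End Coxeter.

HB.instance Definition _ (R : pzSemiRingType) n :=
  Monoid.isLaw.Build 'M[R]_n 1%:M (@mulmx R n n n)
    (@mulmxA R n n n n) (@mul1mx R n n) (@mulmx1 R n n).

(** * Passage of generators through the elements w_J *)

Section Words.
Variables (R : realType) (N : nat).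
Local Notation s := (s R N).
Local Notation sprod := (sprod R N).
Local Notation wgen := (wgen R N).
Local Notation wJ := (wJ R N).

Lemma sprod_cons i u : sprod (i :: u) = s i *m sprod u.
Proof. by rewrite /sprod big_cons. Qed.

Lemma sprod_cat u v : sprod (u ++ v) = sprod u *m sprod v.
Proof. by rewrite /sprod big_cat. Qed.

Lemma wgenS j : wgen j.+1 = s j.+1 *m wgen j.
Proof.
by rewrite /wgen -[X in iota 1 X]addn1 iotaD cats1 rev_rcons sprod_cons add1n.
Qed.

Lemma s_wgen_far k j : (j.+1 < k <= N)%N -> s k *m wgen j = wgen j *m s k.
Proof.
elim: j => [|j IHj] jk; first by rewrite /wgen /sprod big_nil mulmx1 mul1mx.
rewrite wgenS mulmxA -s_comm; try lia.
by rewrite -!mulmxA IHj //; lia.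
Qed.

(** The letter s_k commutes with s_j, .., s_(k+2), becomes s_(k+1) by the braid relation at s_(k+1)
    s_k, and commutes with the rest. *)
Lemma s_wgen_near k j : (2 <= k < j)%N -> (j <= N)%N ->
  s k *m wgen j = wgen j *m s k.+1.
Proof.
elim: j => [|j IHj] kj jN; first by lia.
have [kj'|jk] := ltnP k j.
  by rewrite wgenS mulmxA s_comm; try lia; rewrite -!mulmxA IHj //; lia.
have <- : k = j by lia.
case: k kj {jk IHj} => [|k] kj; first by lia.
rewrite !wgenS !mulmxA s_braid; try lia.
by rewrite -!mulmxA s_wgen_far //; lia.
Qed.

(** Since w_(k+1) = s_(k+1) w_k, this is the passage of s_(k+1) through w_k w_(k+1), from which it
    emerges as s_2. The relation of order four is the base case. *)
Lemma wgen_sq k : (0 < k < N)%N ->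
  wgen k.+1 *m wgen k.+1 = wgen k *m wgen k.+1 *m s 2%N.
Proof.
elim: k => [|k IHk] kN; first by lia.
case: k IHk kN => [|k] IHk kN.
  by rewrite !wgenS /wgen /sprod big_nil mulmx1 !mulmxA s_braid4.
have comm : s k.+3 *m wgen k.+1 = wgen k.+1 *m s k.+3.
  by rewrite s_wgen_far //; lia.
(* Pulling the first letter of the second factor across [wgen k.+1] exposes a braid. *)
transitivity (s k.+3 *m s k.+2 *m s k.+3 *m (wgen k.+1 *m wgen k.+2)).
  rewrite [wgen k.+3]wgenS {1}[wgen k.+2]wgenS -!mulmxA.
  by rewrite (mulmxA (wgen k.+1) (s k.+3)) -comm !mulmxA.
rewrite -s_braid; try lia.
rewrite -!mulmxA (mulmxA (s k.+2) (wgen k.+1)) -wgenS IHk; try lia.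
rewrite [wgen k.+3]wgenS !mulmxA; congr (_ *m _ *m _).
by rewrite -(mulmxA (s k.+2)) comm mulmxA -wgenS.
Qed.

Lemma wJ_cons j J : wJ (j :: J) = wgen j *m wJ J.
Proof. by rewrite /wJ big_cons. Qed.

(** For k >= 2, s_k exchanges the entries k-1 and k, so equal membership means that it fixes J. It
    is carried through the factors of w_J from left to right and leaves as a generator of
    W(A_(N-1)). *)
Lemma s_wJ_stab J k : (2 <= k <= N)%N -> sorted ltn J ->
    all (fun j => j <= N)%N J -> (k.-1 \in J) = (k \in J) ->
  exists2 k', (2 <= k' <= N)%N & s k *m wJ J = wJ J *m s k'.
Proof.
(* The case [k = j.+1] consumes two factors at once, so the induction is on a bound for the size. *)
have [n] := ubnP (size J); elim: n => // n IHn in J k *.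
case: J => [|j J] /=.
  by move=> _ kN _ _ _; exists k; rewrite // /wJ big_nil mulmx1 mul1mx.
rewrite ltnS => Jn kN jJ /andP[jN JN]; rewrite !in_cons.
have /allP ltjJ := order_path_min ltn_trans jJ.
have sJ := path_sorted jJ.
have notin i : (i <= j)%N -> (i \in J) = false.
  by move=> ij; apply/negP => /ltjJ; lia.
rewrite wJ_cons.
have [kj|jk|kj] := ltngtP k j.
- move=> _; have [] := IHn J k.+1 => //; try by lia.
    by rewrite !notin //; lia.
  move=> k' k'N e; exists k' => //.
  by rewrite mulmxA s_wgen_near -?mulmxA ?e ?mulmxA //; lia.
- have [kj|kj] := eqVneq k.-1 j.
    rewrite /= => /esym kJ.
    (* Membership forces the next factor to be w_k. By [wgen_sq] the letter leaves these two factors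
       as s_2, and it fixes the remaining set, whose elements exceed 2. *)
    case: J => [//|j' J] in Jn jJ JN kJ ltjJ sJ notin *; rewrite /= in Jn.
    have kj' : k = j'.
      move: kJ; rewrite in_cons => /orP[/eqP//|kJ].
      have /allP/(_ _ kJ) := order_path_min ltn_trans sJ.
      have := ltjJ j'; rewrite mem_head => /(_ isT) /=; lia.
    have /allP ltj'J := order_path_min ltn_trans sJ.
    have [] := IHn J 2%N => //; try by lia.
    + exact: path_sorted sJ.
    + by case/andP: JN.
    + by apply/idP/idP => /ltj'J /=; lia.
    move=> k' k'N e; exists k' => //.
    rewrite wJ_cons -kj' !mulmxA.
    have -> : k = j.+1 by lia.
    by rewrite -wgenS wgen_sq; [rewrite -!mulmxA e|lia].
  rewrite /= => kJ.
  have [] := IHn J k => // k' k'N e; exists k' => //.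
  by rewrite mulmxA s_wgen_far -?mulmxA ?e //; lia.
(* Here k = j lies in the set but k-1 does not, contrary to the assumption. *)
- by rewrite -kj /= notin ?orbF => [/eqP|]; lia.
Qed.
End Words.

(* A subset of {1, .., N} is encoded by a predicate on nat, which is only
   evaluated on {1, .., N}. *)
Definition gen_act (i : nat) (P : pred nat) : pred nat :=
  if i == 1%N then fun k => P k (+) (k == 1%N)
  else fun k => P (if k == i then i.-1 else if k == i.-1 then i else k).

Lemma gen_actK i P : (0 < i)%N -> gen_act i (gen_act i P) =1 P.
Proof.
move=> i0 k; rewrite /gen_act; case: eqP => [_|i1].
  by rewrite -addbA addbb addbF.
congr (P _); do !case: eqP => //; lia.
Qed.

(** * Action of the generators on subsets and on the elements w_J *)

Section Subsets.
Variables (R : realType) (N : nat).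
Local Notation s := (s R N).
Local Notation sprod := (sprod R N).
Local Notation wgen := (wgen R N).
Local Notation wJ := (wJ R N).
Implicit Types (P Q : pred nat).

Definition eq_upto P Q := forall j, (1 <= j <= N)%N -> P j = Q j.

Definition wset P : 'M[R]_N := wJ [seq j <- iota 1 N | P j].

Lemma wsetE P : wset P = \big[mulmx/1%:M]_(1 <= j < N.+1 | P j) wgen j.
Proof. by rewrite /wset /wJ big_filter /index_iota subn1. Qed.

Definition weight P : nat := (\sum_(1 <= j < N.+1 | P j) j)%N.

Definition signs P : 'cV[R]_N := \col_k (-1) ^+ P k.+1.

Lemma eq_wset P Q : eq_upto P Q -> wset P = wset Q.
Proof. by move=> PQ; rewrite !wsetE; apply: congr_big_nat. Qed.

Lemma eq_weight P Q : eq_upto P Q -> weight P = weight Q.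
Proof. by move=> PQ; apply: congr_big_nat. Qed.

Lemma signs_inj P Q : signs P = signs Q -> eq_upto P Q.
Proof.
move=> /matrixP PQ [|j] // jN.
by have := PQ (Ordinal jN) 0; rewrite !mxE; apply: signr_inj.
Qed.

Lemma eq_signs P Q : eq_upto P Q -> signs P = signs Q.
Proof. by move=> PQ; apply/matrixP => i j; rewrite !mxE PQ //=. Qed.

Lemma s_signs i P : (1 <= i <= N)%N -> s i *m signs P = signs (gen_act i P).
Proof.
case: i => [|i] // iN; rewrite reflectionE; apply/matrixP => k j.
rewrite !ord1 !mxE {j} /gen_act eqSS.
case: eqP => [i0|i1].
  rewrite i0 in iN *; rewrite dotp_alpha1 // divr1.
  rewrite (dotp_eps (Ordinal iN)) !mxE /= eqSS.
  case: eqP => [->|_]; last by rewrite mulr0 subr0 addbF.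
  by rewrite addbT; case: (P 1%N); rewrite /=; ring.
case: i i1 iN => [//|i] _ iN.
rewrite dotp_alpha // divff ?pnatr_eq0 // mul1r alpha_succ dotpBl.
rewrite (dotp_eps (Ordinal iN)) (dotp_eps (Ordinal (ltnW iN))) !mxE /= !eqSS.
case: eqP => [->|_]; first by rewrite gtn_eqF //=; ring.
by case: eqP => [->|_] /=; ring.
Qed.

(** The constant [c] collects the elements other than k and k+1, and serves [P] and its image under
    [gen_act k.+1] alike. *)
Lemma weight_split k P : (0 < k < N)%N -> exists c,
  forall Q, (forall j, j != k -> j != k.+1 -> Q j = P j) ->
  weight Q = (c + Q k * k + Q k.+1 * k.+1)%N.
Proof.
move=> kN; exists (\sum_(1 <= j < k | P j) j + \sum_(k.+2 <= j < N.+1 | P j) j)%N.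
move=> Q QP; rewrite /weight (@big_cat_nat _ _ _ k) /=; try lia.
rewrite (@big_ltn_cond _ _ _ k); last by lia.
rewrite (@big_ltn_cond _ _ _ k.+1); last by lia.
rewrite (@congr_big_nat _ _ _ 1 k 1 k Q P id id) //; last first.
  by move=> j jk; rewrite QP //; lia.
rewrite (@congr_big_nat _ _ _ k.+2 N.+1 k.+2 N.+1 Q P id id) //; last first.
  by move=> j jk; rewrite QP //; lia.
by case: (Q k); case: (Q k.+1); lia.
Qed.

Lemma weight1 P Q : (0 < N)%N -> (forall j, j != 1%N -> Q j = P j) ->
  (weight Q + P 1 = weight P + Q 1)%N.
Proof.
move=> N0 QP; rewrite /weight !(@big_ltn_cond _ _ _ 1) //.
rewrite (@congr_big_nat _ _ _ 2 N.+1 2 N.+1 Q P id id) //; last first.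
  by move=> j jk; rewrite QP //; lia.
by case: (Q 1%N); case: (P 1%N); lia.
Qed.

(** The factors before w_k have smaller index, so s_(k+1) commutes with them and then turns w_k into
    w_(k+1). *)
Lemma wset_raise k P : (0 < k < N)%N -> P k -> ~~ P k.+1 ->
  s k.+1 *m wset P = wset (gen_act k.+1 P).
Proof.
move=> kN Pk /negbTE PSk; have k0 : k != 0%N by lia.
rewrite !wsetE !(@big_cat_nat _ _ _ k 1 N.+1) /=; try lia.
rewrite !(@big_ltn_cond _ _ _ k); try lia.
rewrite !(@big_ltn_cond _ _ _ k.+1); try lia.
have -> : gen_act k.+1 P k = false.
  by rewrite /gen_act eqSS (negbTE k0) ltn_eqF //= eqxx.
have -> : gen_act k.+1 P k.+1 by rewrite /gen_act eqSS (negbTE k0) eqxx.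
rewrite Pk PSk.
rewrite (@congr_big_nat _ _ _ 1 k 1 k (gen_act _ _) P wgen wgen) //; last first.
  move=> j jk; rewrite /gen_act eqSS (negbTE k0) !ltn_eqF //; lia.
rewrite (@congr_big_nat _ _ _ k.+2 N.+1 k.+2 N.+1 (gen_act _ _) P wgen wgen) //;
    last first.
  move=> j jk; rewrite /gen_act eqSS (negbTE k0) !gtn_eqF //; lia.
rewrite wgenS !mulmxA; congr (_ *m _ *m _).
rewrite big_nat_cond; elim/big_rec: _ => [|j A /andP[jk _] IHA].
  by rewrite mulmx1 mul1mx.
by rewrite mulmxA s_wgen_far -?mulmxA ?IHA //; lia.
Qed.

Lemma wset_cons1 P : (0 < N)%N -> ~~ P 1%N ->
  s 1%N *m wset P = wset (gen_act 1%N P).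
Proof.
move=> N0 P1; rewrite !wsetE !(@big_ltn_cond _ _ _ 1) //.
have -> : gen_act 1%N P 1%N by rewrite /gen_act /= (negbTE P1).
rewrite (negbTE P1) wgenS {2}/wgen /sprod big_nil mulmx1.
congr (_ *m _); apply: congr_big_nat => // j jN.
by rewrite /gen_act /= gtn_eqF ?addbF //; lia.
Qed.

(** The membership conditions serve to exclude cases later: [wset_word] rules out an ascent with
    them, and [ins_set_step] a descent. *)
Variant step_spec i P : Prop :=
  | StepUp of s i *m wset P = wset (gen_act i P)
      & weight (gen_act i P) = (weight P).+1 & ~~ P i
  | StepDown of s i *m wset P = wset (gen_act i P)
      & weight P = (weight (gen_act i P)).+1 & P i & (i == 1%N) || ~~ P i.-1
  | StepStay k of gen_act i P =1 P & (2 <= k <= N)%N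
      & s i *m wset P = wset P *m s k.

Lemma stepP i P : (1 <= i <= N)%N -> step_spec i P.
Proof.
case: i => [|[|k]] // iN.
  have wP := @weight1 P (gen_act 1%N P) iN.
  have {}wP : (weight (gen_act 1%N P) + P 1 = weight P + ~~ P 1)%N.
    by rewrite wP; [rewrite /gen_act /= addbT|by move=> j /negbTE;
      rewrite /gen_act /= => ->; rewrite addbF].
  case P1: (P 1%N) wP => /= wP; last first.
    by apply: StepUp; [rewrite wset_cons1 ?P1|lia|rewrite P1].
  apply: StepDown => //; last by lia.
  (* A descent is the ascent from [gen_act 1 P], undone by the involution s_1. *)
  have <- : wset (gen_act 1%N (gen_act 1%N P)) = wset P.
    by apply: eq_wset => j _; rewrite gen_actK.
  rewrite -(wset_cons1 (P := gen_act 1%N P)) //; last by rewrite /gen_act /= P1.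
  by rewrite mulmxA sK // mul1mx.
have kN : (0 < k.+1 < N)%N by lia.
have gE : (gen_act k.+2 P k.+1 = P k.+2) * (gen_act k.+2 P k.+2 = P k.+1).
  by rewrite /gen_act /= !eqxx ltn_eqF.
have gE' j : j != k.+1 -> j != k.+2 -> gen_act k.+2 P j = P j.
  by rewrite /gen_act /= => /negbTE-> /negbTE->.
have [c wE] := weight_split P kN.
have wQ := wE _ gE'; rewrite !gE in wQ.
have wP := wE P (fun _ _ _ => erefl).
have stay : P k.+1 = P k.+2 -> step_spec k.+2 P.
  move=> P12.
  have [||||k' k'N e] := @s_wJ_stab R N [seq j <- iota 1 N | P j] k.+2 => //.
  + exact: sorted_filter ltn_trans _ _ (iota_ltn_sorted _ _).
  + by apply/allP => j; rewrite mem_filter mem_iota; lia.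
  + by rewrite !mem_filter !mem_iota P12; lia.
  apply: (StepStay (k := k')) => // j.
  have [->|j1] := eqVneq j k.+1; first by rewrite gE P12.
  have [->|j2] := eqVneq j k.+2; first by rewrite gE P12.
  exact: gE'.
case P1: (P k.+1) wP wQ stay; case P2: (P k.+2) => wP wQ stay.
- exact: stay.
- by apply: StepUp; [rewrite wset_raise ?P2|lia|rewrite P2].
- apply: StepDown; rewrite ?P1 //; last by lia.
  have <- : wset (gen_act k.+2 (gen_act k.+2 P)) = wset P.
    by apply: eq_wset => j _; rewrite gen_actK.
  by rewrite -(wset_raise (P := gen_act k.+2 P)) ?gE ?P1 ?P2 // mulmxA sK // mul1mx.
- exact: stay.
Qed.
End Subsets.

(** * Lengths and minimal coset representatives *)

Section Lengths.
Variables (R : realType) (N : nat).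
Local Notation s := (s R N).
Local Notation sprod := (sprod R N).
Local Notation wset := (wset R N).
Local Notation signs := (signs R N).
Local Notation weight := (weight N).
Local Notation valid := (all (fun i => 1 <= i <= N)%N).
Implicit Types (P Q : pred nat) (u : seq nat).

Lemma wset0 : wset pred0 = 1%:M.
Proof. by rewrite wsetE big_pred0. Qed.

Lemma weight0 : weight pred0 = 0%N.
Proof. by rewrite /weight big_pred0. Qed.

Lemma sprod_signs u P : valid u ->
  sprod u *m signs P = signs (foldr gen_act P u).
Proof.
elim: u => [_|i u IHu /= /andP[iN uN]].
  by rewrite /sprod big_nil mul1mx.
by rewrite sprod_cons -mulmxA IHu // s_signs.
Qed.

Lemma sprod_rev u : valid u -> sprod u *m sprod (rev u) = 1%:M.
Proof.
elim: u => [_|i u IHu /= /andP[iN uN]].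
  by rewrite /sprod big_nil mul1mx.
rewrite rev_cons -cats1 sprod_cat !sprod_cons /sprod big_nil mulmx1 -/sprod.
by rewrite -!mulmxA (mulmxA (sprod u)) IHu // mul1mx sK.
Qed.

Lemma WA_M v w : WA N v -> WA N w -> @WA R N N (v *m w).
Proof.
move=> vW wW H HW; have [[_ _ HM _] _] := HW.
by apply: HM; [apply: vW|apply: wW].
Qed.

Lemma WA_V v : WA N v -> @WA R N N (invmx v).
Proof. by move=> vW H HW; have [[_ _ _ HV] _] := HW; apply: HV; exact: vW. Qed.

Lemma WA_1 : @WA R N N 1%:M.
Proof. by move=> H [[]]. Qed.

Lemma WA_s k : (2 <= k <= N)%N -> WA N (s k).
Proof. by move=> kN; apply: sub_gen_smallest; exists k. Qed.

(** Words in s_2, .., s_N form a subgroup because reversing a word of involutions inverts it. *)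
Lemma WA_word v : WA N v ->
  exists2 u, all (fun i => 2 <= i <= N)%N u & v = sprod u.
Proof.
have val u : all (fun i => 2 <= i <= N)%N u -> valid u.
  by apply: sub_all => i /=; lia.
pose H := [set sprod u | u in [set u | all (fun i => 2 <= i <= N)%N u]].
suff WH : @WA R N N `<=` H by move=> /WH[u uN <-]; exists u.
apply: smallest_sub; last first.
  move=> _ [k kN <-]; exists [:: k]; first by rewrite /= andbT.
  by rewrite sprod_cons /sprod big_nil mulmx1.
split.
- by move=> _ [u /val/sprod_rev/mulmx1_unit[uU _] <-].
- by exists [::] => //; rewrite /sprod big_nil.
- move=> _ _ [u uN <-] [v' vN <-]; exists (u ++ v'); last exact: sprod_cat.
  by rewrite /= all_cat uN.
- move=> _ [u uN <-]; exists (rev u); first by rewrite /= all_rev.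
  have e := sprod_rev (val _ uN); have [uU _] := mulmx1_unit e.
  by rewrite -[LHS](mulKmx uU) e mulmx1.
Qed.

(** Generators of index at least 2 permute coordinates and fix the all-ones vector. Hence the image
    of that vector depends only on the coset. *)
Lemma WA_signs v : WA N v -> v *m signs pred0 = signs pred0.
Proof.
move=> /WA_word[u uN ->]; rewrite sprod_signs; last first.
  by apply: sub_all uN => i /=; lia.
congr signs; elim: u uN => //= i u IHu /andP[iN /IHu ->].
by apply/funext => k; rewrite /gen_act gtn_eqF //; lia.
Qed.

Lemma sprod_coset u : valid u ->
  exists2 v, WA N v & sprod u = wset (foldr gen_act pred0 u) *m v.
Proof.
elim: u => [_|i u IHu /= /andP[iN /IHu[v vW e]]].
  by exists 1%:M; [exact: WA_1|rewrite wset0 mulmx1 /sprod big_nil].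
rewrite sprod_cons e mulmxA.
have [-> _ _|-> _ _ _|k ge kN ->] := stepP R (foldr gen_act pred0 u) iN.
- by exists v.
- by exists v.
- exists (s k *m v); first by apply: WA_M => //; exact: WA_s.
  by rewrite mulmxA; congr (_ *m _ *m _); apply: eq_wset => j _; rewrite ge.
Qed.

(* Each letter raises the weight by at most one, and if it does raise it then
   it maps [wset P] to [wset (gen_act i P)] on the nose; hence the minimal
   representative of a coset is unique. *)
Lemma sprod_min u : valid u ->
  (weight (foldr gen_act pred0 u) <= size u)%N /\
  (weight (foldr gen_act pred0 u) = size u ->
   sprod u = wset (foldr gen_act pred0 u)).
Proof.
elim: u => [_|i u IHu /= /andP[iN /IHu[le_u eq_u]]].
  by rewrite /= weight0 wset0 /sprod big_nil.
rewrite sprod_cons.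
have [sw wt _|sw wt _ _|k ge kN sw] := stepP R (foldr gen_act pred0 u) iN.
- by rewrite wt ltnS; split=> // -[/eq_u ->].
- by split; lia.
- rewrite (_ : weight _ = weight (foldr gen_act pred0 u)); last first.
    by apply: eq_weight => j _.
  by split; lia.
Qed.

(** The smallest element of the set is lowered by one, or removed if it is 1, until the set is
    empty. Each letter lowers the weight by exactly one. *)
Lemma wset_word P : exists u,
  [/\ valid u, size u = weight P, sprod u = wset P &
      sprod u *m signs pred0 = signs P].
Proof.
have [n] := ubnP (weight P); elim: n => // n IHn in P *.
rewrite ltnS => Pn.
have [exP|noP] := pselect (exists i, (1 <= i <= N)%N && P i); last first.
  have P0 : eq_upto N pred0 P.
    move=> j jN; apply/esym/negP => Pj; apply: noP; exists j.
    by rewrite jN.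
  exists [::]; rewrite -(eq_weight P0) -(eq_wset R P0) -(eq_signs R P0) weight0.
  by rewrite wset0 /sprod big_nil mul1mx.
have [i /andP[iN Pi] i_min] := ex_minnP exP.
(* By minimality [i] is 1 or [i.-1] is not in [P], so [s i] cannot fix [P]. *)
have gi : gen_act i P i = false.
  rewrite /gen_act; case: eqP => [i1|i1]; first by rewrite Pi i1.
  by rewrite eqxx; apply/negP => Pi1; have := i_min i.-1; rewrite Pi1; lia.
have [sw wt|sw wt _ _|k ge] := stepP R P iN.
- by rewrite Pi.
- have [|u [uN su eu gu]] := IHn (gen_act i P); first by lia.
  exists (i :: u); rewrite /= iN uN su wt sprod_cons eu; split=> //.
    by rewrite -sw mulmxA sK // mul1mx.
  rewrite -eu -mulmxA gu s_signs //.
  by apply: eq_signs => j _; rewrite gen_actK //; case/andP: iN.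
- by rewrite -ge gi in Pi.
Qed.

Lemma wset_signs P : wset P *m signs pred0 = signs P.
Proof. by have [u [_ _ <-]] := wset_word P. Qed.

Lemma word_weight P u : valid u -> sprod u *m signs pred0 = signs P ->
  (weight P <= size u)%N /\ (weight P = size u -> sprod u = wset P).
Proof.
move=> uN; rewrite sprod_signs // => /signs_inj eP.
by rewrite -(eq_weight eP) -(eq_wset R eP); apply: sprod_min.
Qed.

(** A shortest expression exists as soon as there is any, so [xget] returns a true minimum and not
    its default. *)
Lemma lenP (w : 'M[R]_N) k : expressible N w k ->
  expressible N w (len N w) /\
  forall k', expressible N w k' -> (len N w <= k')%N.
Proof.
move=> wk; apply: (@xgetPex _ 0%N [set k | expressible N w k /\
  forall k', expressible N w k' -> (k <= k')%N]).
have ex : exists k, `[< expressible N w k >] by exists k; apply/asboolP.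
have [l /asboolP wl l_min] := ex_minnP ex; exists l; split=> // k' wk'.
by apply: l_min; apply/asboolP.
Qed.

Lemma expressible_weight P (w : 'M[R]_N) k : w *m signs pred0 = signs P ->
  expressible N w k -> (weight P <= k)%N /\ (weight P = k -> w = wset P).
Proof. by move=> wP [u [uN <- uw]]; rewrite -uw in wP *; apply: word_weight. Qed.

Lemma expressible_wset P : expressible N (wset P) (weight P).
Proof. by have [u [uN su eu _]] := wset_word P; exists u. Qed.

Lemma len_wset P : len N (wset P) = weight P.
Proof.
have [lw l_min] := lenP (expressible_wset P).
have [le_l _] := expressible_weight (wset_signs P) lw.
by apply/eqP; rewrite eqn_leq le_l l_min //; apply: expressible_wset.
Qed.

(** All elements of the coset have the sign vector of [P], hence length at least [weight P], with
    equality only for [wset P]. *)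
Lemma minrep_sprod u P : valid u -> sprod u *m signs pred0 = signs P ->
  minrep N (sprod u) = wset P.
Proof.
move=> uN uP.
have wP : coset N (sprod u) (wset P).
  have [v vW e] := sprod_coset uN.
  have /signs_inj eP : signs (foldr gen_act pred0 u) = signs P.
    by rewrite -sprod_signs.
  have [u' u'N ev] := WA_word vW.
  have [vU _] : v \in unitmx /\ True.
    rewrite ev; have/sprod_rev/mulmx1_unit[//] : valid u'.
    by apply: sub_all u'N => i /=; lia.
  exists (invmx v); first exact: WA_V.
  by rewrite e (eq_wset R eP) mulmxK.
have cosetP y : coset N (sprod u) y ->
    (exists k, expressible N y k) /\ y *m signs pred0 = signs P.
  move=> [v vW <-]; split; last by rewrite -mulmxA WA_signs.
  have [u' u'N ->] := WA_word vW; exists (size (u ++ u')).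
  exists (u ++ u'); split=> //; last exact: sprod_cat.
  rewrite all_cat uN; apply: sub_all u'N => i /=; lia.
apply: xget_unique.
  split=> // y /cosetP[[k /lenP[yl _]] yP].
  by rewrite len_wset; have [] := expressible_weight yP yl.
move=> y [/cosetP[[k /lenP[yl _]] yP] y_min].
have [le_l] := expressible_weight yP yl; apply.
by apply/eqP; rewrite eqn_leq le_l -len_wset y_min.
Qed.

Lemma act_wset u P : valid u ->
  act N (sprod u) (wset P) = wset (foldr gen_act P u).
Proof.
move=> uN; have [u' [u'N _ eu' gu']] := wset_word P.
rewrite /act -eu' -sprod_cat; apply: minrep_sprod; first by rewrite all_cat uN.
by rewrite sprod_cat -mulmxA gu' sprod_signs.
Qed.

(** The support condition keeps track of the rank m, because [wset] refers to the ambient dimension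
    N. *)
Lemma MB_wset m (w : 'M[R]_N) : (m <= N)%N -> MB m w ->
  exists2 P, w = wset P & forall j, P j -> (1 <= j <= m)%N.
Proof.
move=> mN [J [sJ JN] <-]; exists (mem J); last by move=> j /(allP JN).
congr wJ; apply: (irr_sorted_eq ltn_trans ltnn) => //.
  exact: sorted_filter ltn_trans _ _ (iota_ltn_sorted _ _).
move=> j; rewrite mem_filter mem_iota; case jJ: (j \in J) => /=.
  by have := allP JN _ jJ; lia.
by rewrite jJ.
Qed.

Lemma wset_MB P : MB N (wset P).
Proof.
exists [seq j <- iota 1 N | P j] => //; split.
  exact: sorted_filter ltn_trans _ _ (iota_ltn_sorted _ _).
by apply/allP => j; rewrite mem_filter mem_iota; lia.
Qed.
End Lengths.

(** * Insertions into sign vectors and their weights *)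

Definition insert_bit (b : bool) (i : nat) (P : pred nat) : pred nat :=
  fun k => if (k < i)%N then P k else if k == i then b else P k.-1.

(* [ins_set m j P] encodes the action of the j-th insertion word of rank m on
   the subset [P] of {1, .., m}. *)
Definition ins_set (m j : nat) (P : pred nat) : pred nat :=
  if (j <= m)%N then insert_bit false (m.+1 - j) P
  else insert_bit true (j - m) P.

(* The letter by which the (j+1)-st insertion word extends the j-th. *)
Definition ins_letter (m j : nat) : nat :=
  (if j < m then m.+1 - j else j.+1 - m)%N.

Fixpoint ins_word (m j : nat) : seq nat :=
  if j is j'.+1 then ins_letter m j' :: ins_word m j' else [::].

Section Insertion.
Variable m : nat.
Implicit Types (i j k : nat) (P : pred nat).

(** The letters run down from s_(m+1) to s_1, which is reached at [j = m], and then up again to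
    s_(m+1). *)
Lemma insS (R : realType) N j : (j <= 2 * m)%N ->
  ins R N m j.+1 = s R N (ins_letter m j) *m ins R N m j.
Proof.
move=> jm; rewrite /ins /ins_letter /ins_low.
case: ltngtP => [jm'|mj|->].
- have -> : (m + 2 - j.+1 = m.+1 - j)%N by lia.
  have -> : (m + 2 - j = (m.+1 - j).+1)%N by lia.
  by rewrite /= sprod_cons.
- have -> : (j.+1 - m = (j - m).+1)%N by lia.
  by rewrite -/(wgen R N _.+1) wgenS -mulmxA.
- rewrite subSnn -/(wgen R N 1) wgenS.
  by rewrite /wgen /sprod big_nil mulmx1.
Qed.

Lemma ins_sprod (R : realType) N j : (j <= 2 * m + 1)%N ->
  ins R N m j = sprod R N (ins_word m j).
Proof.
elim: j => [_|j IHj jm]; first by rewrite /ins /ins_low /= /sprod big_nil.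
by rewrite insS ?IHj ?sprod_cons //; lia.
Qed.

Lemma ins_word_valid j : (j <= 2 * m + 1)%N ->
  all (fun i => 1 <= i <= m.+1)%N (ins_word m j).
Proof.
elim: j => //= j IHj jm; rewrite IHj ?andbT; last by lia.
by rewrite /ins_letter; case: (ltnP j m); lia.
Qed.

Lemma gen_act_insert1 b P :
  gen_act 1%N (insert_bit b 1%N P) = insert_bit (~~ b) 1%N P.
Proof.
by apply/funext => -[|[|k]]; rewrite /gen_act /insert_bit /= ?addbF ?addbT.
Qed.

Lemma gen_act_insert b i P : (0 < i)%N ->
  gen_act i.+1 (insert_bit b i.+1 P) = insert_bit b i P.
Proof.
move=> i0; apply/funext => k; rewrite /gen_act eqSS gtn_eqF // /insert_bit /=.
have [->|ki1] := eqVneq k i.+1.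
  by rewrite ltnSn gtn_eqF // ltnNge leqnSn.
have [->|ki] := eqVneq k i; first by rewrite !ltnn eqxx.
by rewrite ltnS leq_eqVlt (negbTE ki) (negbTE ki1).
Qed.

Lemma gen_act_insert_pred b i P : (0 < i)%N ->
  gen_act i.+1 (insert_bit b i P) = insert_bit b i.+1 P.
Proof.
move=> i0; rewrite -(gen_act_insert b P i0).
by apply/funext => k; rewrite gen_actK.
Qed.

Lemma ins_setS j P :
  ins_set m j.+1 P = gen_act (ins_letter m j) (ins_set m j P).
Proof.
rewrite /ins_set /ins_letter; have [jm|mj|->] := ltngtP j m.
- have -> : (m.+1 - j)%N = (m - j).+1 by lia.
  by rewrite gen_act_insert ?subn_gt0 // subSS.
- by rewrite subSn ?gen_act_insert_pred ?subn_gt0 // ltnW.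
- by rewrite subSnn gen_act_insert1.
Qed.

(** The walk starts from a set of rank m seen in rank m+1, that is, with [false] at the new position
    m+1. *)
Lemma foldr_ins_word j P :
  foldr gen_act (insert_bit false m.+1 P) (ins_word m j) = ins_set m j P.
Proof.
elim: j => [|j IHj] /=; first by rewrite /ins_set subn0.
by rewrite IHj -ins_setS.
Qed.

(* An insertion letter never moves the inserted entry so as to lower the
   weight: it moves a [false] to the left, negates it, then moves a [true] to
   the right. *)
Lemma ins_set_step (R : realType) j P : (j <= 2 * m)%N ->
  weight m.+1 (ins_set m j.+1 P) = (weight m.+1 (ins_set m j P)).+1 \/
  eq_upto m.+1 (ins_set m j.+1 P) (ins_set m j P).
Proof.
move=> jm; rewrite ins_setS.
have iN : (1 <= ins_letter m j <= m.+1)%N.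
  by rewrite /ins_letter; case: (ltnP j m); lia.
have [_ wt _|_ _ Pi Pi1|k ge _ _] := stepP R (ins_set m j P) iN.
- by left.
- exfalso; move: Pi Pi1; rewrite /ins_letter /ins_set /insert_bit.
  case: (ltngtP j m) => [jm'|mj|->].
  + by rewrite ltnn eqxx.
  + by rewrite [_.-1](_ : _ = (j - m)%N) ?ltnn ?eqxx ?orbF => [_ /eqP|]; lia.
  + by rewrite !subSnn ltnn.
- by right=> k' _.
Qed.

Lemma weight_ins_set0 P :
  weight m.+1 (ins_set m 0 P) = (\sum_(1 <= j < m.+1 | P j) j)%N.
Proof.
rewrite /weight big_mkcond big_nat_recr //= -big_mkcond /= /ins_set /= subn0.
rewrite {2}/insert_bit ltnn eqxx addn0; apply: congr_big_nat => // j jm.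
by rewrite /insert_bit; case: ltnP => //; lia.
Qed.

(** The end points of the walk thus delimit m+2 consecutive integers, one for each residue class
    modulo n+1, where n = m+1. *)
Lemma weight_ins_set_last P :
  weight m.+1 (ins_set m (2 * m + 1) P) = (weight m.+1 (ins_set m 0 P) + m.+1)%N.
Proof.
rewrite weight_ins_set0.
rewrite /weight big_mkcond big_nat_recr //= -big_mkcond /=.
have -> : ins_set m (2 * m + 1) P = insert_bit true m.+1 P.
  by rewrite /ins_set ifF; [congr insert_bit|]; lia.
rewrite {2}/insert_bit ltnn eqxx; congr (_ + _)%N; apply: congr_big_nat => // j jm.
by rewrite /insert_bit; case: ltnP => //; lia.
Qed.

(** A step raises the weight by one or changes nothing, so equal weights mean that nothing changed
    in between. *)
Lemma ins_set_mono (R : realType) P i j : (i <= j <= 2 * m + 1)%N ->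
  (weight m.+1 (ins_set m i P) <= weight m.+1 (ins_set m j P))%N /\
  (weight m.+1 (ins_set m i P) = weight m.+1 (ins_set m j P) ->
   eq_upto m.+1 (ins_set m i P) (ins_set m j P)).
Proof.
elim: j => [|j IHj] ij; first by have -> : i = 0%N by lia.
have [ij'|] := leqP i j; last by move=> ?; have -> : i = j.+1 by lia.
have [|le_ij eq_ij] := IHj; first by lia.
have [|wt|eqj] := @ins_set_step R j P; first by lia.
  by rewrite wt; split; lia.
rewrite (eq_weight eqj); split=> // /eq_ij ij'' k kN.
by rewrite ij'' // eqj.
Qed.

(** A discrete intermediate value argument: steps rise by at most one, so no value is skipped. *)
Lemma ins_set_ivt (R : realType) P t :
  (weight m.+1 (ins_set m 0 P) <= t <= weight m.+1 (ins_set m 0 P) + m.+1)%N ->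
  exists2 j, (j <= 2 * m + 1)%N & weight m.+1 (ins_set m j P) = t.
Proof.
rewrite -weight_ins_set_last.
(* The induction runs over the end point [l] of the walk, while the bound on [j] stays
   [2 * m + 1]. *)
move: {1 3}(2 * m + 1)%N (leqnn (2 * m + 1)) => l.
elim: l => [|j IHj] jm wt.
  by exists 0%N => //; lia.
have [|e|eqj] := @ins_set_step R j P; first by lia.
- have [le_t|] := leqP t (weight m.+1 (ins_set m j P)).
    have [||i ij wi] := IHj; try by lia.
    by exists i => //; lia.
  by exists j.+1 => //; lia.
- have [||i ij wi] := IHj; first by lia.
    by rewrite -(eq_weight eqj).
  by exists i => //; lia.
Qed.
End Insertion.

(** * Insertion spheres and the perfect code *)

Lemma iS_wset (R : realType) m (P : pred nat) (w : 'M[R]_m.+1) :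
  (forall j, P j -> (1 <= j <= m)%N) ->
  iS m (wset R m.+1 P) w <->
  exists2 j, (j <= 2 * m + 1)%N & w = wset R m.+1 (ins_set m j P).
Proof.
move=> Pm.
have actE j : (j <= 2 * m + 1)%N ->
    act m.+1 (ins R m.+1 m j) (wset R m.+1 P) = wset R m.+1 (ins_set m j P).
  move=> jm; rewrite ins_sprod // -foldr_ins_word -act_wset ?ins_word_valid //.
  (* [P] does not contain m+1, so inserting [false] there leaves [wset] unchanged. *)
  congr act; apply: eq_wset => k kN; rewrite /insert_bit.
  case: ltngtP => // [|->]; first by lia.
  by apply/negbTE/negP => /Pm; lia.
split=> [[j /= jm <-]|[j jm ->]]; first by exists j; rewrite ?actE.
by exists j; rewrite /= ?actE.
Qed.

Theorem corollary5p6 (R : realType) (n : nat) (hn : (0 < n)%N) (a : int) :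
  (forall w w' : 'M[R]_n, Mcode R n a w -> Mcode R n a w' -> w <> w' ->
     dS n w `&` dS n w' = set0) /\
  \bigcup_(w in Mcode R n a) dS n w = MB n.-1 :> set 'M[R]_n.
Proof.
case: n hn => // m _; split=> [w w' [_ wa] [_ w'a] ww'|].
  apply/seteqP; split=> // y [[/= yM yw] [_ yw']]; apply: ww'.
  have [P yP Pm] := MB_wset (leqnSn m) yM; rewrite yP in yw yw'.
  have [i im wi] := (iS_wset w Pm).1 yw.
  have [j jm wj] := (iS_wset w' Pm).1 yw'.
  rewrite wi len_wset in wa; rewrite wj len_wset in w'a; rewrite wi wj.
  clear - wa w'a im jm.
  wlog ij : i j im jm wa w'a / (i <= j)%N => [H|].
    by have [/H|/ltnW/H] := leqP i j => [|e]; [|symmetry]; auto.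
  have [|le_ij eq_ij] := @ins_set_mono m R P i j; first by lia.
  have [|le_0i _] := @ins_set_mono m R P 0 i; first by lia.
  have [|le_j1 _] := @ins_set_mono m R P j (2 * m + 1); first by lia.
  rewrite weight_ins_set_last in le_j1.
  apply/eq_wset/eq_ij.
  (* Both weights lie in an interval of length m+1 and are congruent modulo m+2, so they agree. *)
  move: wa; rewrite -w'a => wij; clear - le_ij le_0i le_j1 wij.
  move: wij; rewrite !modz_nat => -[/eqP]; rewrite eq_sym eqn_mod_dvd //.
  have [/eqP|d0] := posnP (weight m.+1 (ins_set m j P) - weight m.+1 (ins_set m i P)).
    by rewrite subn_eq0 => le_ji _; apply/eqP; rewrite eqn_leq le_ij.
  by move/(dvdn_leq d0); lia.
apply/seteqP; split=> [y [w _ [] //]|y yM].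
have [P yP Pm] := MB_wset (leqnSn m) yM.
set c := weight m.+1 (ins_set m 0 P).
(* The representative of the class of [a] among c, .., c+m+1. *)
pose t := (c + `|((a - c%:Z) %% m.+2%:Z)%Z|)%N.
have d_ge0 : (0 <= (a - c%:Z) %% m.+2%:Z)%Z by apply: modz_ge0.
have d_lt : ((a - c%:Z) %% m.+2%:Z < m.+2%:Z)%Z by apply: ltz_pmod.
have [|j jm wt] := @ins_set_ivt m R P t; first by rewrite -/c /t; lia.
exists (wset R m.+1 (ins_set m j P)); last first.
  by split=> //; rewrite yP; apply/iS_wset => //; exists j.
split; first exact: wset_MB.
rewrite len_wset wt /t PoszD gez0_abs // modzDmr.
by rewrite addrC subrK.
Qed.
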